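(* Suppose $p\neq2$ and let $\alpha,\beta_1,\beta_2\in\widehat{\mathbb{F}_q^\times}$ with $\varepsilon\notin\{\beta_1,\beta_2\}$. Then for $\lambda\in\mathbb{F}_q$, $\lambda\neq1$, $$F_2\!\left({\alpha^2;\beta_1,\beta_2\atop\beta_1^2,\beta_2^2};1+\lambda,1-\lambda\right)=\overline{\alpha}^2\Big(\frac{1-\lambda}{2}\Big)\sum_{\alpha'\in\{\alpha,\alpha\phi\}}\frac{(\overline{\beta_2}\phi)_{\alpha'}}{(\phi)_{\alpha'}}\,{}_2F_1\!\left({\alpha',\alpha'\overline{\beta_2}\phi\atop\beta_1\phi};\Big(\frac{1+\lambda}{1-\lambda}\Big)^2\right).$$
   Context: $\mathbb{F}_q$ is a finite field with $q$ elements and characteristic $p$. $\widehat{\mathbb{F}_q^\times}$ is the group of multiplicative characters $\mathbb{F}_q^\times\to\overline{\mathbb{Q}}^\times$, $\varepsilon$ the trivial character, $\phi$ the quadratic character; every character (including $\varepsilon$) is extended by $0$ at $0$; $\overline{\eta}=\eta^{-1}$; $\delta(\eta)=1$ if $\eta=\varepsilon$, else $0$. $\psi$ is a fixed non-trivial additive character. $g(\eta)=-\sum_{x\in\mathbb{F}_q^\times}\psi(x)\eta(x)$, $g^\circ(\eta)=q^{\delta(\eta)}g(\eta)$, $(\alpha)_\nu=g(\alpha\nu)/g(\alpha)$, $(\alpha)^\circ_\nu=g^\circ(\alpha\nu)/g^\circ(\alpha)$. For $\lambda\in\mathbb{F}_q$, ${}_2F_1\!\left({\alpha,\beta\atop\gamma};\lambda\right)=\frac{1}{1-q}\sum_{\nu}\frac{(\alpha)_\nu(\beta)_\nu}{(\varepsilon)^\circ_\nu(\gamma)^\circ_\nu}\nu(\lambda)$;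 for $x,y\in\mathbb{F}_q$, $F_2\!\left({\alpha;\beta_1,\beta_2\atop\gamma_1,\gamma_2};x,y\right)=\frac{1}{(1-q)^2}\sum_{\nu_1,\nu_2}\frac{(\alpha)_{\nu_1\nu_2}(\beta_1)_{\nu_1}(\beta_2)_{\nu_2}}{(\gamma_1)^\circ_{\nu_1}(\gamma_2)^\circ_{\nu_2}(\varepsilon)^\circ_{\nu_1}(\varepsilon)^\circ_{\nu_2}}\nu_1(x)\nu_2(y)$, sums over characters. *)

(* Defs.v *)
From HB Require Import structures.
From mathcomp Require Import all_boot all_order all_algebra all_fingroup all_solvable all_field all_character.
Set Implicit Arguments. Unset Strict Implicit. Unset Printing Implicit Defensive.
Import Order.TTheory GRing.Theory Num.Theory.
Local Open Scope ring_scope.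

(* Characters of F_q^x are realised as the irreducible (= linear, the group is
   abelian) characters of the unit group {unit F}, valued in algC, and
   extended by 0 at 0.  Sums over all characters are sums over Iirr. *)

Section FFHyp.
Variable F : finFieldType.

Definition UG : {group {unit F}} := [set: {unit F}]%G.

Definition mchar (i : Iirr UG) : F -> algC :=
  fun x => if @insub F (fun y => y \is a GRing.unit) {unit F} x is Some u
           then 'chi[UG]_i u else 0.

Definition qF : algC := (#|F|)%:R.

Definition eps : F -> algC := fun x => if x == 0 then 0 else 1.

Definition phiq : F -> algC :=
  fun x => if x == 0 then 0 else if [exists y : F, y ^+ 2 == x] then 1 else -1.

Definition cmul (a b : F -> algC) : F -> algC := fun x => a x * b x.
Definition cbar (a : F -> algC) : F -> algC := fun x => (a x)^-1.

Definition delta (eta : F -> algC) : nat := [forall x : F, eta x == eps x].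

Variable psi : F -> algC.

Definition gauss (eta : F -> algC) : algC :=
  - \sum_(x : F | x != 0) psi x * eta x.
Definition gaussc (eta : F -> algC) : algC := qF ^+ delta eta * gauss eta.

Definition poch (a nu : F -> algC) : algC := gauss (cmul a nu) / gauss a.
Definition pochc (a nu : F -> algC) : algC := gaussc (cmul a nu) / gaussc a.

Definition F21 (a b c : F -> algC) (l : F) : algC :=
  (1 - qF)^-1 * \sum_(n : Iirr UG)
     (poch a (mchar n) * poch b (mchar n)
      / (pochc eps (mchar n) * pochc c (mchar n)) * mchar n l).

Definition Appell2 (a b1 b2 c1 c2 : F -> algC) (x y : F) : algC :=
  ((1 - qF) ^+ 2)^-1 * \sum_(n1 : Iirr UG) \sum_(n2 : Iirr UG)
     (poch a (cmul (mchar n1) (mchar n2)) * poch b1 (mchar n1) * poch b2 (mchar n2)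
      / (pochc c1 (mchar n1) * pochc c2 (mchar n2)
         * pochc eps (mchar n1) * pochc eps (mchar n2))
      * mchar n1 x * mchar n2 y).

End FFHyp.

Definition additive_char (F : finFieldType) (psi : F -> algC) : Prop :=
  psi 0 = 1 /\ (forall x y, psi (x + y) = psi x * psi y).

(* Main.v *)
(* The Gauss sum g(alpha^2 nu1 nu2) turns F_2 into a sum over t of
   psi(t) alpha^2(t) times two 1F1's at t(1 + lambda) and t(1 - lambda).
   Kummer's second theorem rewrites these as psi(- t(1 +- lambda) / 2) times a
   0F1 in t^2, and the three additive factors cancel because
   (1 + lambda) + (1 - lambda) = 2.  What remains depends on t only through t^2
   (apart from alpha^2(t) = alpha(t^2)), so summing over m = t^2 with weight
   1 + phi(m) produces the two characters alpha and alpha phi; the sum over m is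
   then a Mellin transform of 0F1 * 0F1, which is the 2F1 of the right-hand side
   up to constants matched by the duplication formula for Gauss sums. *)

Require Import Defs.
From HB Require Import structures.
From mathcomp Require Import all_boot all_order all_algebra all_fingroup all_solvable all_field all_character.
From mathcomp Require Import ring.
Set Implicit Arguments. Unset Strict Implicit. Unset Printing Implicit Defensive.
Import GRing.Theory Num.Theory.
Local Open Scope ring_scope.

(** * Multiplicative characters extended by zero *)

Section MulChar.
Variable F : finFieldType.
Implicit Types (x y z : F) (chi a b c : F -> algC).

Local Notation q := (qF F).
Local Notation eps := (@eps F).
Local Notation phi := (@phiq F).

(** A predicate on functions instead of an index in [Iirr]: products, inverses and the quadratic
    character can then be treated without finding their index. *)
Definition mulchar chi : Prop :=
  [/\ chi 0 = 0, chi 1 = 1 & {morph chi : x y / x * y}].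

Lemma mulchar_neq0 chi x : mulchar chi -> x != 0 -> chi x != 0.
Proof.
case=> _ h1 hM x0; apply/eqP=> h; have := hM x x^-1.
by rewrite mulfV // h1 h mul0r => /eqP; rewrite oner_eq0.
Qed.

Lemma mulcharV chi x : mulchar chi -> chi x^-1 = (chi x)^-1.
Proof.
move=> hc; have [h0 h1 hM] := hc.
have [->|x0] := eqVneq x 0; first by rewrite !(invr0, h0).
apply: (mulfI (mulchar_neq0 hc x0)).
by rewrite -hM !mulfV // (mulchar_neq0 hc).
Qed.

Lemma mulchar_cmul a b : mulchar a -> mulchar b -> mulchar (cmul a b).
Proof.
move=> [a0 a1 aM] [b0 b1 bM]; split; rewrite /cmul ?a0 ?a1 ?b1 ?mul0r ?mulr1 //.
by move=> x y; rewrite aM bM mulrACA.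
Qed.

Lemma mulchar_cbar a : mulchar a -> mulchar (cbar a).
Proof.
move=> [a0 a1 aM]; split; rewrite /cbar ?a0 ?a1 ?invr0 ?invr1 //.
by move=> x y; rewrite aM invfM.
Qed.

Lemma mulchar_eps : mulchar eps.
Proof.
split; rewrite /Defs.eps ?eqxx ?oner_eq0 // => x y.
by rewrite mulf_eq0; do 2?case: eqP; rewrite ?mulr1 ?mulr0.
Qed.

Lemma mulchar_sqrN1 chi : mulchar chi -> chi (-1) ^+ 2 = 1.
Proof. by case=> _ h1 hM; rewrite expr2 -hM mulrNN mulr1. Qed.

Lemma insub_unit x (u : {unit F}) : val u = x ->
  @insub F (fun y => y \is a GRing.unit) {unit F} x = Some u.
Proof. by move=> <-; rewrite valK. Qed.

Lemma insub_unitP x : x != 0 -> exists u : {unit F}, val u = x.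
Proof.
by rewrite -unitfE => ux; exists (FinRing.unit F ux).
Qed.

Lemma mchar_unit (i : Iirr (UG F)) (u : {unit F}) :
  mchar i (val u) = 'chi_i u.
Proof. by rewrite /mchar (@insub_unit _ u). Qed.

Lemma abelian_UG : abelian (UG F).
Proof. exact/cyclic_abelian/field_unit_group_cyclic. Qed.

Lemma mchar0 (i : Iirr (UG F)) : mchar i 0 = 0.
Proof. by rewrite /mchar insubF // unitr0. Qed.

Lemma mulchar_mchar (i : Iirr (UG F)) : mulchar (mchar i).
Proof.
have lin : 'chi_i \is a linear_char by apply/char_abelianP/abelian_UG.
have h1 : mchar i 1 = 1.
  by rewrite -[1]/(val (1%g : {unit F})) mchar_unit lin_char1.
split=> // [|x y]; first exact: mchar0.
have [->|x0] := eqVneq x 0; first by rewrite mul0r !mchar0 mul0r.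
have [->|y0] := eqVneq y 0; first by rewrite mulr0 !mchar0 mulr0.
have [[u <-] [v <-]] := (insub_unitP x0, insub_unitP y0).
rewrite -[_ * _]/(val (u * v)%g) !mchar_unit.
by apply: (lin_charM lin); rewrite inE.
Qed.

Lemma card_gt1 : (1 < #|F|)%N.
Proof. by apply/card_gt1P; exists 0, 1; rewrite eq_sym oner_eq0. Qed.

Lemma qF_neq0 : q != 0.
Proof. by rewrite /qF pnatr_eq0 -lt0n (ltnW card_gt1). Qed.

Lemma oneBqF_neq0 : 1 - q != 0.
Proof.
by rewrite subr_eq0 eq_sym /qF pnatr_eq1 gtn_eqF // card_gt1.
Qed.

(** Second orthogonality against the class of 1: the group is abelian, so every irreducible
    character is 1 there and the centraliser is the whole group, of order q - 1. *)
Lemma sum_mchar x : \sum_(i : Iirr (UG F)) mchar i x = (q - 1) *+ (x == 1).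
Proof.
have [->|x0] := eqVneq x 0.
  by rewrite eq_sym oner_eq0 big1 // => i _; exact: mchar0.
have [u <-] := insub_unitP x0; under eq_bigr do rewrite mchar_unit.
rewrite (eq_bigr (fun i => 'chi_i u * ('chi_i 1%g)^*)) => [|i _]; last first.
  have lin : 'chi_i \is a linear_char by apply/char_abelianP/abelian_UG.
  by rewrite (lin_char1 lin) conjC1 mulr1.
rewrite second_orthogonality_relation ?inE //.
rewrite class1G inE -[X in val u == X]/(val (1%g : {unit F})) (inj_eq val_inj).
have [->|//] := eqVneq u 1%g.
rewrite cent11T setIT card_finField_unit /qF -subn1 natrB //.
exact: ltnW card_gt1.
Qed.

Lemma exists_primitive : exists2 w, w != 0 & forall x, x != 0 -> exists k, x = w ^+ k.
Proof.
have /cyclicP[w hw] := field_unit_group_cyclic (UG F).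
exists (val w) => [|x /insub_unitP[u <-]]; first by rewrite -unitfE (valP w).
have /cycleP[k ->] : u \in <[w]>%g by rewrite -hw inE.
by exists k; rewrite FinRing.val_unitX.
Qed.

Lemma sum_scale (f : F -> algC) (s : F) :
  s != 0 -> \sum_x f x = \sum_x f (s * x).
Proof. by move=> s0; rewrite (reindex_inj (mulfI s0)). Qed.

Lemma sum_mulchar_nontriv chi : mulchar chi -> delta chi = 0%N -> \sum_x chi x = 0.
Proof.
move=> hc; have [h0 h1 hM] := hc.
move=> /eqP; rewrite eqb0 => /forallPn[y hy].
have y0 : y != 0.
  by apply: contraNneq hy => ->; rewrite h0 /Defs.eps eqxx.
have hy1 : chi y != 1 by move: hy; rewrite /Defs.eps (negPf y0).
have /eqP := sum_scale chi y0; under [X in _ == X]eq_bigr do rewrite hM.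
rewrite -mulr_sumr -subr_eq0 -{1}[X in X - _]mul1r -mulrBl mulf_eq0 subr_eq0.
by rewrite eq_sym (negPf hy1) => /eqP.
Qed.

End MulChar.

(** * The quadratic character in odd characteristic *)

Section Quadratic.
Variable F : finFieldType.
Hypothesis two_neq0 : (2 : F) != 0.
Implicit Types (x y z : F) (chi : F -> algC).

Local Notation q := (qF F).
Local Notation eps := (@eps F).
Local Notation phi := (@phiq F).

Lemma eq_oppr_self x : (x == - x) = (x == 0).
Proof.
by rewrite -subr_eq0 opprK -mulr2n -mulr_natl mulf_eq0 (negPf two_neq0).
Qed.

Lemma exists_nonsquare : exists x, forall y, y ^+ 2 != x.
Proof.
have [/existsP[x /forallP hx]|hn] := boolP [exists x, [forall y : F, y ^+ 2 != x]].
  by exists x.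
have sur x : exists y, y ^+ 2 == x.
  move: hn; rewrite negb_exists => /forallP/(_ x).
  by rewrite negb_forall => /existsP[y]; rewrite negbK; exists y.
(* A right inverse of squaring on a finite set is also a left inverse, so squaring would be
   injective, yet 1 and -1 have the same square. *)
pose s x := xchoose (sur x).
have sK : cancel s (fun y => y ^+ 2) by move=> x; apply/eqP/(xchooseP (sur x)).
have /eqP : 1 = -1 :> F by apply: (can_inj (canF_sym sK)); rewrite sqrrN.
by rewrite eq_oppr_self oner_eq0.
Qed.

(** A generator is a nonsquare, since otherwise all its powers would be squares; hence its squares
    are exactly its even powers. Multiplicativity of [phi] follows. *)
Lemma phiq_primitive : exists w, [/\ w != 0, forall x, x != 0 -> exists k, x = w ^+ k
  & forall k, phi (w ^+ k) = (-1) ^+ k].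
Proof.
have [w w0 hw] := exists_primitive F; exists w; split=> // k.
have wns y : y ^+ 2 != w.
  have [x hx] := exists_nonsquare; apply/eqP=> e.
  have x0 : x != 0 by have := hx 0; rewrite expr0n eq_sym.
  have [n e'] := hw _ x0; have /eqP[] := hx (y ^+ n).
  by rewrite e' -e -!exprM mulnC.
rewrite /phiq expf_eq0 (negPf w0) andbF -signr_odd.
have ek : w ^+ k = w ^+ odd k * (w ^+ k./2) ^+ 2.
  by rewrite -exprM -exprD muln2 odd_double_half.
case: (odd k) ek => ek; last first.
  by rewrite ifT //; apply/existsP; exists (w ^+ k./2); rewrite ek mul1r.
rewrite ifF //; apply/existsP=> -[y /eqP hy].
have /eqP[] := wns (y / w ^+ k./2).
by rewrite expr_div_n hy ek mulfK // !expf_neq0.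
Qed.

Lemma mulchar_phiq : mulchar phi.
Proof.
have [w [w0 hw hphi]] := phiq_primitive.
have h0 : phi 0 = 0 by rewrite /phiq eqxx.
split=> // [|x y]; first by rewrite -(expr0 w) hphi.
have [->|x0] := eqVneq x 0; first by rewrite mul0r h0 mul0r.
have [->|y0] := eqVneq y 0; first by rewrite mulr0 h0 mulr0.
have [[n ->] [m ->]] := (hw _ x0, hw _ y0).
by rewrite -exprD !hphi exprD.
Qed.

Lemma phiq_sqr x : x != 0 -> phi (x ^+ 2) = 1.
Proof.
move=> x0; rewrite /phiq expf_eq0 (negPf x0) andbF ifT //.
by apply/existsP; exists x.
Qed.

Lemma phiq_mul_self x : x != 0 -> phi x * phi x = 1.
Proof. by move=> x0; rewrite -(phiq_sqr x0); case: mulchar_phiq => _ _ <-. Qed.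

Lemma phiqV x : (phi x)^-1 = phi x.
Proof.
have [->|x0] := eqVneq x 0; first by rewrite /phiq eqxx invr0.
by rewrite -[LHS]mul1r -(@phiq_mul_self x) // mulfK // mulchar_neq0 //; exact: mulchar_phiq.
Qed.

(** The fibre of squaring over m has 1 + phi(m) points; this includes m = 0, where [phi] is 0. *)
Lemma sum_sqr (f : F -> algC) : \sum_x f (x ^+ 2) = \sum_m (1 + phi m) * f m.
Proof.
rewrite (partition_big (fun x => x ^+ 2) predT) //=; apply: eq_bigr => m _.
rewrite (eq_bigr (fun=> f m)) => [|x /eqP -> //].
rewrite sumr_const -mulr_natl; congr (_ * _).
rewrite /phiq; have [->|m0] := eqVneq m 0.
  rewrite addr0 (eq_card1 (x := 0)) // => x.
  by rewrite -[LHS]/(x ^+ 2 == 0) inE expf_eq0.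
have [/existsP[y /eqP hy]|hn] := boolP [exists y, y ^+ 2 == m]; last first.
  by rewrite subrr eq_card0 // => x; apply/negP=> hx; case/existsP: hn; exists x.
have y0 : y != 0 by apply: contraNneq m0 => y0; rewrite -hy y0 expr0n.
rewrite (eq_card (B := pred2 y (- y))) => [|x]; last first.
  by rewrite -[LHS]/(x ^+ 2 == m) !inE -hy eqf_sqr.
by rewrite card2 eq_oppr_self y0.
Qed.

(** A character is determined by its value at a generator, here 1 or -1. *)
Lemma mulchar_order2 chi : mulchar chi -> (forall x, x != 0 -> chi (x ^+ 2) = 1) ->
  chi =1 eps \/ chi =1 phi.
Proof.
move=> [h0 h1 hM] hsq; have [w [w0 hw hphi]] := phiq_primitive.
have hX k : chi (w ^+ k) = chi w ^+ k.
  by elim: k => [|k IH]; rewrite ?expr0 // !exprS hM IH.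
have /eqP := hsq w w0; rewrite hX sqrf_eq1 => /orP[]/eqP hcw; [left|right] => x.
  have [->|x0] := eqVneq x 0; first by rewrite h0 /Defs.eps eqxx.
  by have [k ->] := hw _ x0; rewrite hX hcw expr1n /Defs.eps expf_eq0 (negPf w0) andbF.
have [->|x0] := eqVneq x 0; first by rewrite h0 /phiq eqxx.
by have [k ->] := hw _ x0; rewrite hX hcw hphi.
Qed.

End Quadratic.

(** * The indicator of the trivial character *)

Lemma eq_delta (F : finFieldType) (f g : F -> algC) : f =1 g -> delta f = delta g.
Proof. by move=> e; rewrite /delta; under eq_forallb do rewrite e. Qed.

Lemma delta1P (F : finFieldType) (f : F -> algC) : delta f = 1%N -> f =1 @eps F.
Proof. by rewrite /delta; case: forallP => // h _ x; apply/eqP. Qed.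

Lemma deltaP (F : finFieldType) (f : F -> algC) : delta f = 0%N \/ delta f = 1%N.
Proof. by rewrite /delta; case: [forall _, _]; [right|left]. Qed.

Lemma delta_eps (F : finFieldType) (f : F -> algC) : f =1 @eps F -> delta f = 1%N.
Proof. by rewrite /delta => e; case: forallP => // -[] x; apply/eqP. Qed.

Lemma delta_cbar (F : finFieldType) (f : F -> algC) : delta (cbar f) = delta f.
Proof.
rewrite /delta; congr nat_of_bool; apply: eq_forallb => x.
rewrite /cbar /eps; case: ifP => _; first by rewrite invr_eq0.
by rewrite -[X in _ == X]invr1 (inj_eq invr_inj).
Qed.

(** * Gauss sums and the reflection formula *)

Section Gauss.
Variables (F : finFieldType) (psi : F -> algC).
Hypotheses (Hpsi : additive_char psi) (Hpsi_nt : exists x : F, psi x != 1).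
Implicit Types (x y z : F) (chi a b c : F -> algC).

Local Notation q := (qF F).
Local Notation eps := (@eps F).
Local Notation phi := (@phiq F).
Local Notation g := (gauss psi).
Local Notation go := (gaussc psi).

Lemma psi0 : psi 0 = 1. Proof. by case: Hpsi. Qed.
Lemma psiD x y : psi (x + y) = psi x * psi y. Proof. by case: Hpsi. Qed.

Lemma sum_psi_scale z : \sum_x psi (z * x) = q *+ (z == 0).
Proof.
have [->|z0] := eqVneq z 0.
  rewrite (eq_bigr (fun=> 1)) => [|x _]; last by rewrite mul0r psi0.
  by rewrite sumr_const.
rewrite -(sum_scale psi z0); have [y hy] := Hpsi_nt.
have /eqP : \sum_x psi x = psi y * \sum_x psi x.
  rewrite mulr_sumr (reindex_inj (addrI y)).
  by apply: eq_bigr => x _; rewrite psiD.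
rewrite -subr_eq0 -{1}[X in X - _]mul1r -mulrBl mulf_eq0 subr_eq0.
by rewrite eq_sym (negPf hy) => /eqP.
Qed.

Lemma eq_gauss a b : a =1 b -> g a = g b.
Proof. by move=> e; congr (- _); apply: eq_bigr => x _; rewrite e. Qed.

Lemma eq_gaussc a b : a =1 b -> go a = go b.
Proof. by move=> e; rewrite /gaussc (eq_gauss e) (eq_delta e). Qed.

Lemma gaussE chi : mulchar chi -> g chi = - \sum_x psi x * chi x.
Proof.
move=> [h0 _ _]; rewrite /gauss [in RHS](bigD1 0) //= h0 mulr0 add0r.
by congr (- _).
Qed.

Lemma sum_psi_mulchar chi z : mulchar chi -> z != 0 ->
  \sum_x psi (z * x) * chi x = - (chi z)^-1 * g chi.
Proof.
move=> hc z0; have [_ _ hM] := hc.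
rewrite gaussE // mulrNN (sum_scale (fun x => psi x * chi x) z0) mulr_sumr.
by apply: eq_bigr => x _; rewrite hM mulrCA mulKf // (mulchar_neq0 hc).
Qed.

Lemma sum_psi_mulchar_nontriv chi z : mulchar chi -> delta chi = 0%N ->
  \sum_x psi (z * x) * chi x = - (chi z)^-1 * g chi.
Proof.
move=> hc hd; have [->|z0] := eqVneq z 0; last exact: sum_psi_mulchar.
(* At z = 0 the right side is 0 because the inverse of 0 is 0, and the left side is the full sum of
   a nontrivial character. *)
have [h0 _ _] := hc; rewrite h0 invr0 oppr0 mul0r -[RHS](sum_mulchar_nontriv hc hd).
by apply: eq_bigr => x _; rewrite mul0r psi0 mul1r.
Qed.

Lemma gauss_trivial chi : delta chi = 1%N -> g chi = 1.
Proof.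
move=> /delta1P hc; rewrite (eq_gauss hc).
rewrite gaussE; last exact: mulchar_eps.
have := sum_psi_scale 1; rewrite oner_eq0 mulr0n.
under eq_bigr do rewrite mul1r.
rewrite (bigD1 0) //= psi0 [X in - X](bigD1 0) //= /Defs.eps eqxx mulr0 add0r.
move/eqP; rewrite addr_eq0 => /eqP e; rewrite [RHS]e; congr (- _).
by apply: eq_bigr => x /negPf ->; rewrite mulr1.
Qed.

(** For nontrivial chi, summing psi(y(x + 1)) over y isolates x = -1. For trivial chi both Gauss
    sums are 1 and the factor q comes from [gaussc]. *)
Lemma gauss_reflection chi : mulchar chi -> g chi * go (cbar chi) = chi (-1) * q.
Proof.
move=> hc; have [h0 h1 hM] := hc; have hb := mulchar_cbar hc.
rewrite /gaussc delta_cbar; have [hd|hd] := deltaP chi; last first.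
  rewrite hd !gauss_trivial ?delta_cbar // expr1 mulr1 mul1r.
  by rewrite (delta1P hd) /Defs.eps oppr_eq0 oner_eq0 mul1r.
rewrite hd expr0 mul1r [g (cbar chi)]gaussE // mulrN mulr_sumr -sumrN.
(* The subtracted term makes the summand at y = 0 vanish, as it does on the left; in total it costs
   only the sum of chi, which is 0. *)
transitivity (\sum_y \sum_x (psi (y * (x + 1)) * chi x - chi x *+ (y == 0))).
  apply: eq_bigr => y _; rewrite sumrB.
  have [->|y0] := eqVneq y 0.
    rewrite /cbar h0 invr0 !mulr0 oppr0; under eq_bigr do rewrite mul0r psi0 mul1r.
    by under [X in _ - X]eq_bigr do rewrite mulr1n; rewrite subrr.
  under [X in _ - X]eq_bigr do rewrite mulr0n.
  rewrite big1_eq subr0 (eq_bigr (fun x => psi y * (psi (y * x) * chi x))) => [|x _].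
    by rewrite -mulr_sumr sum_psi_mulchar // /cbar; ring.
  by rewrite mulrDr mulr1 psiD; ring.
rewrite exchange_big /=.
transitivity (\sum_x (chi x * (q *+ (x + 1 == 0)) - chi x)).
  apply: eq_bigr => x _; rewrite sumrB; congr (_ - _).
    rewrite -sum_psi_scale mulr_sumr; apply: eq_bigr => y _.
    by rewrite mulrC [y * _]mulrC.
  rewrite (bigD1 0) //= eqxx big1 => [|y /negPf -> //]; by rewrite addr0.
rewrite sumrB (sum_mulchar_nontriv hc hd) subr0 (bigD1 (-1)) //= addNr eqxx.
by rewrite big1 ?addr0 // => x; rewrite addr_eq0 => /negPf ->; rewrite mulr0.
Qed.

Lemma gauss_neq0 chi : mulchar chi -> g chi != 0.
Proof.
move=> hc; apply/eqP => h; have /esym/eqP := gauss_reflection hc.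
rewrite h mul0r mulf_eq0 (negPf (qF_neq0 F)) orbF; apply/negP.
by rewrite (mulchar_neq0 hc) // oppr_eq0 oner_eq0.
Qed.

Lemma gaussc_neq0 chi : mulchar chi -> go chi != 0.
Proof. by move=> hc; rewrite mulf_neq0 ?gauss_neq0 // expf_neq0 // qF_neq0. Qed.

(** Reflection for the inverse character, solved for its Gauss sum; chi(-1) is a sign and so its own
    inverse. *)
Lemma gauss_cbar chi : mulchar chi -> g (cbar chi) = chi (-1) * q / go chi.
Proof.
move=> hc; have hb := mulchar_cbar hc; have := gauss_reflection hb.
rewrite (@eq_gaussc (cbar (cbar chi)) chi); last by move=> x; rewrite /cbar invrK.
move=> h; apply: (mulIf (gaussc_neq0 hc)); rewrite h divfK ?gaussc_neq0 //.
have /eqP := mulchar_sqrN1 hc.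
by rewrite /cbar sqrf_eq1 => /orP[]/eqP->; rewrite ?invrN invr1.
Qed.

End Gauss.

(** * Jacobi sums and the duplication formula *)

Section Hypergeometric.
Variables (F : finFieldType) (psi : F -> algC).
Hypotheses (Hpsi : additive_char psi) (Hpsi_nt : exists x : F, psi x != 1).
Hypothesis two_neq0 : (2 : F) != 0.
Implicit Types (x y z w : F) (chi a b c d : F -> algC).

Local Notation q := (qF F).
Local Notation eps := (@eps F).
Local Notation phi := (@phiq F).
Local Notation g := (gauss psi).
Local Notation go := (gaussc psi).

Let g_neq0 := gauss_neq0 Hpsi Hpsi_nt.
Let go_neq0 := gaussc_neq0 Hpsi Hpsi_nt.
Let g_cbar := gauss_cbar Hpsi Hpsi_nt.
Let Mphi := mulchar_phiq two_neq0.

Definition jacobi a b : algC := \sum_u a u * b (1 - u).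

Lemma four_neq0 : (4 : F) != 0.
Proof. by rewrite -[4]/(2 * 2)%:R natrM mulf_neq0. Qed.

Lemma sixteen_neq0 : (16 : F) != 0.
Proof. by rewrite -[16]/(4 * 4)%:R natrM mulf_neq0 ?four_neq0. Qed.

Lemma mulchar_neq0N1 chi : mulchar chi -> chi (-1) != 0.
Proof. by move=> hc; rewrite (mulchar_neq0 hc) // oppr_eq0 oner_eq0. Qed.

Lemma mulcharN chi x : mulchar chi -> chi (- x) = chi (-1) * chi x.
Proof. by case=> _ _ <-; rewrite mulN1r. Qed.

Lemma gaussc_nontriv chi : delta chi = 0%N -> go chi = g chi.
Proof. by rewrite /gaussc => ->; rewrite expr0 mul1r. Qed.

Lemma fourier_mulchar chi z : mulchar chi -> delta chi = 0%N ->
  \sum_s psi (z * s) * cbar chi s = - chi z * g (cbar chi).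
Proof.
move=> hc hd; rewrite (sum_psi_mulchar_nontriv Hpsi) ?delta_cbar //.
  by rewrite /cbar invrK.
exact: mulchar_cbar.
Qed.

(** Expand b(1 - u) in additive characters, which is valid also at u = 1 because b is nontrivial,
    and sum over u first. Using [gaussc] in the denominator covers the case where ab is trivial. *)
Lemma jacobi_gauss a b : mulchar a -> mulchar b -> delta b = 0%N ->
  jacobi a b = - g a * g b / go (cmul a b).
Proof.
move=> ha hb hd; have hab := mulchar_cmul ha hb.
have e : jacobi a b * g (cbar b) = - (g a / a (-1) * g (cbar (cmul a b))).
  rewrite (gaussE _ (mulchar_cbar hab)) [in RHS]mulrN opprK mulr_sumr mulr_suml.
  transitivity (\sum_u \sum_s - (a u * (psi s * psi (- s * u) * cbar b s))).
    apply: eq_bigr => u _; rewrite -mulrA -[b _ * _]opprK -mulNr -fourier_mulchar //.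
    rewrite mulrN mulr_sumr sumrN; congr (- _); apply: eq_bigr => s _.
    by rewrite -(psiD Hpsi); congr (_ * (psi _ * _)); ring.
  rewrite exchange_big /=; apply: eq_bigr => s _.
  (* The rescaling of a Gauss sum needs s nonzero, as a may be trivial; at s = 0 the inverse
     characters vanish. *)
  have [->|s0] := eqVneq s 0.
    have [b0 _ _] := hb.
    by rewrite /cbar /cmul b0 big1 => [|u _]; rewrite ?mulr0 ?invr0 ?mulr0 // oppr0.
  rewrite sumrN (eq_bigr (fun u => psi s * cbar b s * (psi (- s * u) * a u))) => [|u _];
    last by ring.
  rewrite -mulr_sumr sum_psi_mulchar ?oppr_eq0 //.
  rewrite (mulcharN _ ha) /cbar /cmul !invfM; ring.
have hN := mulchar_neq0N1 ha; have hbN := mulchar_neq0N1 hb.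
have q0 := qF_neq0 F; have gb0 := g_neq0 hb; have gab0 := go_neq0 hab.
apply: (mulIf (g_neq0 (mulchar_cbar hb))); rewrite e !g_cbar // (gaussc_nontriv hd).
rewrite [cmul _ _ (-1)]/cmul; field; by rewrite hN gb0 gab0.
Qed.

Lemma sum_affine (f : F -> algC) : \sum_u f u = \sum_v f ((1 + v) / 2).
Proof.
rewrite (reindex_inj (mulIf (invr_neq0 two_neq0))) (reindex_inj (addrI 1)) //.
Qed.

(** Under u = (1 + v)/2 the product u(1 - u) becomes (1 - v^2)/4, so the weight is even in v. *)
Lemma jacobi_affine b (f : F -> algC) : mulchar b ->
  \sum_u b u * b (1 - u) * f u =
  (b 4)^-1 * \sum_v b (1 - v ^+ 2) * f ((1 + v) / 2).
Proof.
move=> hb; have [_ _ bM] := hb; rewrite sum_affine mulr_sumr; apply: eq_bigr => v _.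
rewrite -(mulcharV _ hb) mulrA -!bM; congr (b _ * _).
by field; rewrite two_neq0 four_neq0.
Qed.

(** After the affine change the sum depends on v^2 = m only. Of the weight 1 + phi(m), the part 1
    sums the nontrivial b to 0. *)
Lemma jacobi_dup b : mulchar b -> delta b = 0%N -> jacobi b b = (b 4)^-1 * jacobi phi b.
Proof.
move=> hb hd; have := jacobi_affine (fun=> 1) hb.
under eq_bigr do rewrite mulr1; under [X in _ * X]eq_bigr do rewrite mulr1.
rewrite /jacobi => ->; congr (_ * _); rewrite (sum_sqr two_neq0 (fun m => b (1 - m))).
under eq_bigr do rewrite mulrDl mul1r; rewrite big_split /= -[RHS]add0r; congr (_ + _).
rewrite -[RHS](sum_mulchar_nontriv hb hd) (reindex_inj (subrI 1)) /=.
by apply: eq_bigr => u _; rewrite subKr.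
Qed.

Lemma gaussc_dup b : mulchar b -> delta b = 0%N ->
  g b * go (cmul b phi) = (b 4)^-1 * g phi * go (cmul b b).
Proof.
move=> hb hd; have := jacobi_dup hb hd; rewrite !jacobi_gauss //.
rewrite (@eq_gaussc _ psi (cmul phi b) (cmul b phi)) => [|x]; last by rewrite /cmul mulrC.
have g0 := g_neq0 hb; have g1 := go_neq0 (mulchar_cmul hb hb).
have g2 := go_neq0 (mulchar_cmul hb Mphi); move=> e.
transitivity (- (- g b * g b / go (cmul b b)) * go (cmul b b) * go (cmul b phi) / g b).
  by field; rewrite g0 g1.
by rewrite e; field; rewrite g0 g2 (mulchar_neq0 hb four_neq0).
Qed.

Lemma cmul_phiq_sqr a : mulchar a -> cmul (cmul a phi) (cmul a phi) =1 cmul a a.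
Proof.
move=> [a0 _ _] x; rewrite /cmul; have [->|x0] := eqVneq x 0; first by rewrite a0 !mul0r.
by rewrite mulrACA phiq_mul_self // mulr1.
Qed.

(* Davenport-Hasse duplication *)
Lemma gauss_dup a : mulchar a ->
  g a * g (cmul a phi) = (a 4)^-1 * g phi * g (cmul a a).
Proof.
move=> ha; have [hd|/[dup] hd /delta1P ea] := deltaP a; last first.
  have x1 : a 4 = 1 by rewrite ea /Defs.eps (negPf four_neq0).
  have [a0 _ _] := ha; have [p0 _ _] := Mphi.
  rewrite x1 invr1 mul1r (@eq_gauss _ psi (cmul a phi) phi) => [|x]; last first.
    by rewrite /cmul ea /Defs.eps; case: eqP => [->|_]; rewrite ?p0 ?mul0r ?mul1r.
  have -> : g (cmul a a) = g a; last exact: mulrC.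
  by apply: eq_gauss => x; rewrite /cmul ea /Defs.eps; case: eqP => _; rewrite ?mul0r ?mul1r.
(* The powers of q on the two sides of [gaussc_dup] cancel: for nontrivial a, both a phi and a^2 are
   trivial exactly when a = phi. *)
suff e : delta (cmul a phi) = delta (cmul a a).
  have := gaussc_dup ha hd; rewrite /gaussc e [LHS]mulrCA [RHS]mulrCA.
  by apply: mulfI; rewrite expf_neq0 // qF_neq0.
have h : a =1 phi -> delta (cmul a phi) = delta (cmul a a).
  by move=> e; apply: eq_delta => x; rewrite /cmul e.
have [h1|/delta1P h1] := deltaP (cmul a phi); last first.
  apply: h => x; have := h1 x; have [->|x0] := eqVneq x 0.
    by have [-> _ _] := ha; have [-> _ _] := Mphi.
  rewrite /cmul /Defs.eps (negPf x0) => e; rewrite -[LHS]mulr1 -(phiq_mul_self two_neq0 x0).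
  by rewrite mulrA e mul1r.
have [->//|/delta1P h2] := deltaP (cmul a a).
have [x x0|/delta_eps|/h ->//] := mulchar_order2 two_neq0 ha.
  have [_ _ aM] := ha; rewrite expr2 aM; have := h2 x.
  by rewrite /cmul /Defs.eps (negPf x0).
by rewrite hd.
Qed.

(** * Confluent functions 0F1 and 1F1 as character sums *)

Definition F01 c w : algC :=
  (1 - q)^-1 * \sum_(n : Iirr (UG F))
    (pochc psi eps (mchar n) * pochc psi c (mchar n))^-1 * mchar n w.

Definition F11 b c z : algC :=
  (1 - q)^-1 * \sum_(n : Iirr (UG F))
    poch psi b (mchar n) / (pochc psi c (mchar n) * pochc psi eps (mchar n)) * mchar n z.

(** Reflection turns a denominator into a Gauss sum of the inverse character, which can be expanded
    as a sum over the field. *)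
Lemma pochcV c chi : mulchar c -> mulchar chi ->
  (pochc psi c chi)^-1 = chi (-1) * g (cbar (cmul c chi)) / g (cbar c).
Proof.
move=> hc hx; have hcx := mulchar_cmul hc hx.
have c1 := mulchar_neq0N1 hc; have q0 := qF_neq0 F.
have g1 := go_neq0 hc; have g2 := go_neq0 hcx.
rewrite !g_cbar // /pochc -[LHS]mulr1 -(mulchar_sqrN1 hx) [cmul _ _ (-1)]/cmul; field.
by rewrite c1 q0 g1 g2.
Qed.

Lemma pochc_epsV chi : mulchar chi -> (pochc psi eps chi)^-1 = chi (-1) * g (cbar chi).
Proof.
move=> hx; rewrite pochcV //; last exact: mulchar_eps.
rewrite [g (cbar eps)](gauss_trivial Hpsi Hpsi_nt) ?delta_cbar ?delta_eps // divr1.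
congr (_ * _); apply: eq_gauss => x; rewrite /cbar /cmul /Defs.eps.
by case: eqP => [->|_]; [have [-> _ _] := hx|]; rewrite ?mulr0 ?mul1r.
Qed.

(** Mellin inversion: after expanding the Gauss sum, orthogonality over n keeps only x = w. The sign
    of 1 - q is that in the definition of g. *)
Lemma gauss_inversion w : w != 0 ->
  \sum_(n : Iirr (UG F)) mchar n w * g (cbar (mchar n)) = (1 - q) * psi w.
Proof.
move=> w0.
transitivity (- \sum_x psi x * \sum_(n : Iirr (UG F)) mchar n (w / x)).
  under [in RHS]eq_bigr do rewrite mulr_sumr; rewrite exchange_big -sumrN /=.
  apply: eq_bigr => n _; have hn := mulchar_mchar n; have [_ _ nM] := hn.
  rewrite gaussE; last exact: mulchar_cbar.
  rewrite mulrN mulr_sumr; congr (- _); apply: eq_bigr => x _.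
  by rewrite nM mulcharV // mulrCA.
rewrite (bigD1 w) //= sum_mchar divff // eqxx big1 => [|x xw].
  by rewrite addr0 mulr1n -mulrN opprB mulrC.
rewrite sum_mchar; case: eqP => [e|_]; last by rewrite mulr0.
have x0 : x != 0 by apply: contraTneq (oner_neq0 F) => x0; rewrite -e x0 invr0 mulr0 eqxx.
by case/eqP: xw; rewrite -[LHS]mul1r -e divfK.
Qed.

(** The 0F1 is a twisted Kloosterman sum: expand the Gauss sum coming from c over t, then apply
    Mellin inversion at w/t to the one coming from [eps]. The two signs n(-1) cancel. *)
Lemma F01_kloosterman c w : mulchar c -> w != 0 ->
  F01 c w = - (g (cbar c))^-1 * \sum_t psi (t + w / t) * cbar c t.
Proof.
move=> hc w0; have hcb := mulchar_cbar hc; have [c0 _ _] := hcb.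
rewrite /F01; apply: (mulfI (oneBqF_neq0 F)); rewrite mulVKf ?oneBqF_neq0 //.
rewrite mulrCA mulNr -mulrN mulr_sumr.
transitivity ((g (cbar c))^-1 * \sum_t - (psi t * cbar c t) *
   \sum_(n : Iirr (UG F)) mchar n (w / t) * g (cbar (mchar n))).
  under [in RHS]eq_bigr do rewrite mulr_sumr; rewrite exchange_big mulr_sumr /=.
  apply: eq_bigr => n _; have hn := mulchar_mchar n; have [_ _ nM] := hn.
  rewrite invfM pochc_epsV // pochcV // (gaussE _ (mulchar_cbar (mulchar_cmul _ _))) //.
  rewrite [in RHS](eq_bigr (fun t => - (mchar n w * g (cbar (mchar n))) *
     (psi t * cbar (cmul c (mchar n)) t))) => [|t _]; last first.
    by rewrite nM mulcharV // /cbar /cmul invfM; ring.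
  rewrite -mulr_sumr; set S := \sum_t _; have e := mulchar_sqrN1 hn.
  transitivity (- (mchar n (-1) ^+ 2 * g (cbar (mchar n)) * S / g (cbar c) * mchar n w)).
    by ring.
  by rewrite e; ring.
rewrite -sumrN; congr (_ * _); apply: eq_bigr => t _.
have [->|t0] := eqVneq t 0; first by rewrite c0 !mulr0 oppr0 mul0r.
by rewrite gauss_inversion ?mulf_neq0 ?invr_neq0 // (psiD Hpsi); ring.
Qed.

(** Analogue of Euler's integral: the quotient of the symbols of b and b^2 is J(bn, b)/J(b, b), and
    Mellin inversion sums the remaining series to psi. *)
Lemma F11_integral b z : mulchar b -> delta b = 0%N -> z != 0 ->
  F11 b (cmul b b) z = (jacobi b b)^-1 * \sum_u b u * b (1 - u) * psi (- z * u).
Proof.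
move=> hb hd z0; have hbb := mulchar_cmul hb hb; have [b0 _ _] := hb.
rewrite /F11; apply: (mulfI (oneBqF_neq0 F)); rewrite mulVKf ?oneBqF_neq0 //.
rewrite mulrCA mulr_sumr.
transitivity ((jacobi b b)^-1 * \sum_u (b u * b (1 - u)) *
   \sum_(n : Iirr (UG F)) mchar n (- z * u) * g (cbar (mchar n))).
  under [in RHS]eq_bigr do rewrite mulr_sumr; rewrite exchange_big mulr_sumr /=.
  apply: eq_bigr => n _; have hn := mulchar_mchar n; have [_ _ nM] := hn.
  rewrite invfM pochc_epsV // /poch /pochc invf_div.
  have hbn := mulchar_cmul hb hn.
  rewrite [in RHS](eq_bigr (fun u => (mchar n (-1) * mchar n z * g (cbar (mchar n))) *
     (cmul b (mchar n) u * b (1 - u)))) => [|u _]; last first.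
    by rewrite nM (mulcharN _ hn) /cmul; ring.
  rewrite -mulr_sumr -/(jacobi _ _) !jacobi_gauss //.
  rewrite (@eq_gaussc _ psi (cmul (cmul b b) (mchar n)) (cmul (cmul b (mchar n)) b)); last first.
    by move=> x; rewrite /cmul mulrAC.
  have g1 := g_neq0 hb; have g2 := go_neq0 hbb; have g3 := go_neq0 (mulchar_cmul hbn hb).
  by field; rewrite g1 g2 g3.
congr (_ * _); apply: eq_bigr => u _.
have [->|u0] := eqVneq u 0; first by rewrite b0 !mul0r mulr0.
by rewrite gauss_inversion ?mulf_neq0 ?oppr_eq0 //; ring.
Qed.

Lemma quadratic_gauss z : z != 0 -> \sum_v psi (z * v ^+ 2) = - phi z * g phi.
Proof.
move=> z0; rewrite (sum_sqr two_neq0 (fun m => psi (z * m))).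
under eq_bigr do rewrite mulrDl mul1r [phi _ * _]mulrC; rewrite big_split /=.
rewrite (sum_psi_scale Hpsi Hpsi_nt) (negPf z0) mulr0n add0r.
by rewrite sum_psi_mulchar // phiqV.
Qed.

(** Expanding b(1 - v^2) over s leaves a quadratic Gauss sum in v; its factor phi(-s) twists b by
    [phi] and a Kloosterman sum in s remains. *)
Lemma sum_quadratic_phase b y : mulchar b -> delta b = 0%N ->
  \sum_v b (1 - v ^+ 2) * psi (y * v) = phi (-1) * g phi / g (cbar b) *
    \sum_s psi (s + y ^+ 2 / 4 / s) * cbar (cmul b phi) s.
Proof.
move=> hb hd; have gb0 := g_neq0 (mulchar_cbar hb); have [b0 _ _] := hb.
apply: (mulIf gb0); rewrite [RHS]mulrAC divfK // mulr_sumr mulr_suml.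
transitivity (\sum_v \sum_s - (cbar b s * psi ((1 - v ^+ 2) * s + y * v))).
  apply: eq_bigr => v _; rewrite mulrAC -[b _ * _]opprK -mulNr -fourier_mulchar //.
  rewrite mulNr mulr_suml sumrN; congr (- _); apply: eq_bigr => s _.
  by rewrite (psiD Hpsi); ring.
rewrite exchange_big /=; apply: eq_bigr => s _.
have [->|s0] := eqVneq s 0.
  rewrite [cbar (cmul _ _) 0]/cbar [cmul _ _ 0]/cmul b0 mul0r !invr0 !mulr0 big1 // => v _.
  by rewrite /cbar b0 invr0 mul0r oppr0.
(* Completing the square: the shift by y/(2s) turns (1 - v^2)s + yv into s + y^2/(4s) - sv^2. *)
rewrite sumrN -mulr_sumr (reindex_inj (addIr (y / (2 * s)))) /=.
rewrite (eq_bigr (fun v => psi (s + y ^+ 2 / 4 / s) * psi (- s * v ^+ 2))) => [|v _]; last first.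
  rewrite -(psiD Hpsi); congr psi.
  by field; rewrite s0 two_neq0 four_neq0.
rewrite -mulr_sumr quadratic_gauss ?oppr_eq0 //; 
by rewrite (mulcharN _ Mphi) /cbar /cmul invfM phiqV //; ring.
Qed.

(* finite-field form of Kummer's second theorem [1F1(b; 2b; z) = e^(z/2) 0F1(b + 1/2; z^2/16)] *)
Lemma kummer_second b z : mulchar b -> delta b = 0%N ->
  F11 b (cmul b b) z = psi (- z / 2) * F01 (cmul b phi) (z ^+ 2 / 16).
Proof.
move=> hb hd; have hbp := mulchar_cmul hb Mphi; have hbb := mulchar_cmul hb hb.
have [->|z0] := eqVneq z 0.
  rewrite /F11 /F01 expr0n mul0r !big1 ?mulr0 // => n _; by rewrite mchar0 mulr0.
rewrite F11_integral // F01_kloosterman //; last first.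
  by rewrite mulf_neq0 ?invr_neq0 ?sixteen_neq0 ?expf_neq0.
(* With u = (1 + v)/2 the phase splits as psi(-z/2) psi(-zv/2); the frequency -z/2, squared and
   divided by 4, gives z^2/16. *)
rewrite (jacobi_affine (fun u => psi (- z * u))) //.
rewrite [in LHS](eq_bigr (fun v => psi (- z / 2) * (b (1 - v ^+ 2) * psi (- z / 2 * v)))) => [|v _]; last first.
  rewrite [RHS]mulrCA -(psiD Hpsi); congr (_ * psi _).
  by field.
rewrite -mulr_sumr sum_quadratic_phase //.
have -> : (- z / 2) ^+ 2 / 4 = z ^+ 2 / 16.
  by field; rewrite sixteen_neq0 four_neq0 two_neq0.
(* Both sides are now multiples of the same Kloosterman sum S; duplication matches J(b, b) with the
   prefactor of the 0F1. *)
set S := \sum_s _; have e := gaussc_dup hb hd.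
have b4 := mulchar_neq0 hb four_neq0; have g1 := g_neq0 hb; have g2 := go_neq0 hbb.
have g3 := go_neq0 hbp; have q0 := qF_neq0 F; have b1 := mulchar_neq0N1 hb.
have p1 := mulchar_neq0N1 Mphi; have p2 := mulchar_sqrN1 Mphi.
rewrite jacobi_gauss // !g_cbar // (gaussc_nontriv hd).
transitivity (- psi (- z / 2) * S * phi (-1) / (b (-1) * q) / g b
   * ((b 4)^-1 * g phi * go (cmul b b))).
  by field; rewrite q0 b1 b4 g1 g2.
rewrite -e -[LHS]mulr1 -[X in _ * X]invr1 -p2 [cmul _ _ (-1)]/cmul; field.
by rewrite q0 b1 g1 g3 p1.
Qed.

(** * Integral form of F2 and Mellin transforms of 0F1 *)

Lemma Appell2_integral a b1 b2 c1 c2 x y : mulchar a ->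
  Appell2 psi a b1 b2 c1 c2 x y =
  - (g a)^-1 * \sum_t psi t * a t * F11 b1 c1 (t * x) * F11 b2 c2 (t * y).
Proof.
move=> ha; rewrite /Appell2 -exprVn.
(* Only g(a n1 n2) couples n1 and n2. The coefficient A is free of t and is a product, so the double
   sum factors for each t. *)
pose A (n1 n2 : Iirr (UG F)) := poch psi b1 (mchar n1) / (pochc psi c1 (mchar n1)
   * pochc psi eps (mchar n1)) * (poch psi b2 (mchar n2) / (pochc psi c2 (mchar n2)
   * pochc psi eps (mchar n2))).
transitivity ((1 - q)^-1 ^+ 2 * - (g a)^-1 * \sum_(n1 : Iirr (UG F)) \sum_(n2 : Iirr (UG F))
   \sum_t A n1 n2 * (psi t * a t) * (mchar n1 (t * x) * mchar n2 (t * y))).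
  rewrite -[RHS]mulrA [in RHS]mulr_sumr; congr (_ * _); apply: eq_bigr => n1 _.
  rewrite mulr_sumr; apply: eq_bigr => n2 _.
  have [_ _ M1] := mulchar_mchar n1; have [_ _ M2] := mulchar_mchar n2.
  rewrite /poch gaussE; last first.
    by do 2?apply: mulchar_cmul => //; exact: mulchar_mchar.
  rewrite [in RHS](eq_bigr (fun t => A n1 n2 * mchar n1 x * mchar n2 y *
     (psi t * cmul a (cmul (mchar n1) (mchar n2)) t))) => [|t _]; last first.
    by rewrite M1 M2 /cmul; ring.
  by rewrite -mulr_sumr /A /poch !invfM; ring.
rewrite [_ * - _]mulrC -mulrA; congr (_ * _); rewrite mulr_sumr.
under eq_bigr do rewrite exchange_big mulr_sumr /=.
rewrite exchange_big /=; apply: eq_bigr => t _.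
rewrite /F11.
rewrite [RHS](_ : _ = (1 - q)^-1 ^+ 2 * (psi t * a t *
  ((\sum_(n : Iirr (UG F)) poch psi b1 (mchar n) / (pochc psi c1 (mchar n)
   * pochc psi eps (mchar n)) * mchar n (t * x)) *
  (\sum_(n : Iirr (UG F)) poch psi b2 (mchar n) / (pochc psi c2 (mchar n)
   * pochc psi eps (mchar n)) * mchar n (t * y))))); last by ring.
rewrite -mulr_sumr big_distrlr /= [in RHS]mulr_sumr; congr (_ * _); apply: eq_bigr => n1 _.
by rewrite mulr_sumr; apply: eq_bigr => n2 _; rewrite /A; ring.
Qed.

Lemma mellin_F01 chi c y : mulchar chi -> mulchar c -> y != 0 ->
  \sum_m chi m * F01 c (m * y) =
  - (g (cbar c))^-1 * g chi * (chi y)^-1 * g (cmul (cbar c) chi).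
Proof.
move=> hx hc y0; have hcb := mulchar_cbar hc; have [cb0 _ _] := hcb.
have [x0 _ xM] := hx.
rewrite (gaussE _ (mulchar_cmul hcb hx)) mulrN -mulNr mulr_sumr.
transitivity (\sum_m \sum_t - (g (cbar c))^-1 * (psi t * cbar c t * (psi (y / t * m) * chi m))).
  (* The Kloosterman form requires a nonzero argument; at m = 0 the factor chi(m) vanishes. *)
  apply: eq_bigr => m _; have [->|m0] := eqVneq m 0.
    by rewrite x0 mul0r big1 // => t _; rewrite !mulr0.
  rewrite F01_kloosterman ?mulf_neq0 // [LHS]mulrCA -[RHS]mulr_sumr; congr (_ * _); rewrite mulr_sumr.
  apply: eq_bigr => t _; rewrite (psiD Hpsi) -[m * y / t]mulrA [m * _]mulrC; ring.
rewrite exchange_big /=; apply: eq_bigr => t _; rewrite -!mulr_sumr.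
have [->|t0] := eqVneq t 0; first by rewrite /cmul cb0 !(mulr0, mul0r).
rewrite sum_psi_mulchar ?mulf_neq0 ?invr_neq0 // xM mulcharV // invfM invrK /cmul.
ring.
Qed.

(** Only the first 0F1 is expanded; each term is the Mellin transform of the second at a n, whose
    two Gauss sums give the numerator symbols of the 2F1. The character d is fixed only pointwise,
    to admit the product form of the inverse of c2. *)
Lemma sum_F01_F01 a c1 c2 d x y : mulchar a -> mulchar c2 -> y != 0 -> d =1 cbar c2 ->
  \sum_m a m * F01 c1 (m * x) * F01 c2 (m * y) =
  - (a y)^-1 * (g a * g (cmul d a) / g d) * F21 psi a (cmul a d) c1 (x / y).
Proof.
move=> ha hc y0 ed; have hcb := mulchar_cbar hc.
have gd : g d = g (cbar c2) by apply: eq_gauss.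
have gda : g (cmul d a) = g (cmul (cbar c2) a).
  by apply: eq_gauss => t; rewrite /cmul ed.
have gad : g (cmul a d) = g (cmul (cbar c2) a).
  by apply: eq_gauss => t; rewrite /cmul ed mulrC.
have g1 := g_neq0 ha; have g2 := g_neq0 (mulchar_cmul hcb ha).
have g3 := g_neq0 hcb; have a0 := mulchar_neq0 ha y0.
rewrite /F21 {1}/F01.
transitivity ((1 - q)^-1 * \sum_(n : Iirr (UG F)) (pochc psi eps (mchar n) *
   pochc psi c1 (mchar n))^-1 * mchar n x * \sum_m cmul a (mchar n) m * F01 c2 (m * y)).
  under [X in _ = _ * X]eq_bigr do rewrite mulr_sumr.
  rewrite [in RHS]exchange_big [RHS]mulr_sumr; apply: eq_bigr => m _ /=.
  rewrite [a m * _]mulrCA -[LHS]mulrA; congr (_ * _).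
  rewrite mulr_sumr mulr_suml; apply: eq_bigr => n _.
  by have [_ _ nM] := mulchar_mchar n; rewrite nM /cmul; ring.
rewrite mulrCA; congr (_ * _); rewrite mulr_sumr; apply: eq_bigr => n _.
have hn := mulchar_mchar n; have [_ _ nM] := hn; have n0 := mulchar_neq0 hn y0.
rewrite mellin_F01 //; last exact: mulchar_cmul.
rewrite (@eq_gauss _ psi (cmul (cbar c2) (cmul a (mchar n))) (cmul (cmul a d) (mchar n))); last first.
  by move=> t; rewrite /cmul ed; ring.
rewrite /poch gad gda gd [cmul a (mchar n) y]/cmul nM mulcharV //.
set P := (pochc _ _ _ * _)^-1; move: P (mchar n x) (mchar n y) n0 => P nx ny n0.
by field; rewrite g1 g2 g3 a0 n0.
Qed.

End Hypergeometric.

(** * Assembly of the reduction formula *)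

Theorem theorem3p12 (F : finFieldType) (psi : F -> algC)
  (Hpsi : additive_char psi) (Hpsi_nt : exists x : F, psi x != 1)
  (Hp : ~~ (2%N \in [pchar F]))
  (al b1 b2 : Iirr (UG F))
  (Hb1 : delta (mchar b1) = 0%N) (Hb2 : delta (mchar b2) = 0%N)
  (lam : F) (Hlam : lam != 1) :
  let a := mchar al in
  let B1 := mchar b1 in
  let B2 := mchar b2 in
  Appell2 psi (cmul a a) B1 B2 (cmul B1 B1) (cmul B2 B2) (1 + lam) (1 - lam)
  = cmul (cbar a) (cbar a) ((1 - lam) / 2)
    * \sum_(a' <- [:: a; cmul a (phiq (F:=F))])
        (poch psi (cmul (cbar B2) (phiq (F:=F))) a' / poch psi (phiq (F:=F)) a'
         * F21 psi a' (cmul a' (cmul (cbar B2) (phiq (F:=F)))) (cmul B1 (phiq (F:=F)))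
             (((1 + lam) / (1 - lam)) ^+ 2)).
Proof.
move=> a B1 B2; have two_neq0 : (2 : F) != 0 by move: Hp; rewrite inE.
set phi := @phiq F; have hphi : mulchar phi := mulchar_phiq two_neq0.
have [ha hB1 hB2] : [/\ mulchar a, mulchar B1 & mulchar B2].
  by split; exact: mulchar_mchar.
have haa := mulchar_cmul ha ha; have haphi := mulchar_cmul ha hphi.
have hc2 := mulchar_cmul hB2 hphi.
have y0 : 1 - lam != 0 by rewrite subr_eq0 eq_sym.
have xDy : 1 + lam + (1 - lam) = 2 by ring.
(* From here the arguments enter through y nonzero and x + y = 2, the latter for the cancellation of
   the phases. *)
move: (1 + lam) (1 - lam) y0 xDy => x y y0 xDy.
have n4 := four_neq0 two_neq0; have n16 := sixteen_neq0 two_neq0.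
pose f m := F01 psi (cmul B1 phi) (m * (x ^+ 2 / 16))
          * F01 psi (cmul B2 phi) (m * (y ^+ 2 / 16)).
rewrite Appell2_integral //.
have -> : \sum_t psi t * cmul a a t * F11 psi B1 (cmul B1 B1) (t * x)
            * F11 psi B2 (cmul B2 B2) (t * y)
        = \sum_m a m * f m + \sum_m cmul a phi m * f m.
  rewrite -big_split /=.
  transitivity (\sum_m (1 + phi m) * (a m * f m)); last first.
    by apply: eq_bigr => m _; rewrite /cmul; ring.
  rewrite -(sum_sqr two_neq0 (fun m => a m * f m)); apply: eq_bigr => t _.
  rewrite !kummer_second //.
  have e : psi t * psi (- (t * x) / 2) * psi (- (t * y) / 2) = 1.
    rewrite -!(psiD Hpsi) -(psi0 Hpsi); congr psi.
    have {1}-> : t = t * (x + y) / 2 by rewrite xDy mulfK.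
    by field.
  have -> : (t * x) ^+ 2 / 16 = t ^+ 2 * (x ^+ 2 / 16) by rewrite exprMn -mulrA.
  have -> : (t * y) ^+ 2 / 16 = t ^+ 2 * (y ^+ 2 / 16) by rewrite exprMn -mulrA.
  have [_ _ aM] := ha.
  rewrite [a (t ^+ 2)]aM -[RHS]mul1r -e /f /cmul; ring.
(* Both a and a phi have square a^2, so one computation serves the two summands. *)
suff key a' : mulchar a' -> cmul a' a' =1 cmul a a ->
    - (gauss psi (cmul a a))^-1 * \sum_m a' m * f m
  = cmul (cbar a) (cbar a) (y / 2) *
    (poch psi (cmul (cbar B2) phi) a' / poch psi phi a'
     * F21 psi a' (cmul a' (cmul (cbar B2) phi)) (cmul B1 phi) ((x / y) ^+ 2)).
  rewrite !big_cons big_nil addr0 [LHS]mulrDr [RHS]mulrDr.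
  by rewrite !key //; exact: cmul_phiq_sqr.
move=> ha' haa'; under eq_bigr do rewrite /f mulrA.
have ed : cmul (cbar B2) phi =1 cbar (cmul B2 phi).
  by move=> m; rewrite /cbar /cmul invfM phiqV.
have Y0 : y ^+ 2 / 16 != 0 by rewrite mulf_neq0 ?invr_neq0 ?expf_neq0.
rewrite (sum_F01_F01 Hpsi Hpsi_nt _ _ ha' hc2 Y0 ed).
have -> : x ^+ 2 / 16 / (y ^+ 2 / 16) = (x / y) ^+ 2 by field; rewrite y0 n16.
have dup := gauss_dup Hpsi Hpsi_nt two_neq0 ha'.
rewrite (eq_gauss _ haa') in dup.
(* The factor a'(4) is supplied by duplication, and 4y^2/16 = (y/2)^2. *)
have a'M : a' (y ^+ 2 / 16) * a' 4 = cmul a a (y / 2).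
  have [_ _ M] := ha'; rewrite -haa' /cmul -!M; congr a'.
  by field; rewrite n16 two_neq0.
have -> : cmul (cbar a) (cbar a) (y / 2) = (a' (y ^+ 2 / 16) * a' 4)^-1.
  by rewrite a'M /cbar /cmul invfM.
rewrite /poch (@eq_gauss _ psi (cmul phi a') (cmul a' phi)) => [|m]; last first.
  by rewrite /cmul mulrC.
have g_neq0 := gauss_neq0 Hpsi Hpsi_nt.
have gaa := g_neq0 _ haa; have gp := g_neq0 _ hphi.
have gap := g_neq0 _ (mulchar_cmul ha' hphi).
have gd := g_neq0 _ (mulchar_cmul (mulchar_cbar hB2) hphi).
have a4 := mulchar_neq0 ha' n4.
have ay := mulchar_neq0 ha' Y0.
(* Duplication cancels g(a^2) and produces g(phi)/g(a' phi), the inverse of the symbol of [phi] at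
   a'. *)
have -> : gauss psi a' = (a' 4)^-1 * gauss psi phi * gauss psi (cmul a a)
    / gauss psi (cmul a' phi) by rewrite -dup mulfK.
by field; rewrite gaa gp gap gd a4 ay.
Qed.
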